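(* Fix the data $d,\mu,h_0,T,L,f,u_0$ as in the context. There exists a constant $C>0$, independent of $n$, $\Delta t$ and $\Delta\hat z$, such that for all integers $M\ge2$, $N\ge1$ with $\Delta t=T/N<\frac1{2L}$, the solution $\{\hat W_j^n\}$ of the finite difference scheme (S3) described in the context satisfies $$\|\hat W^n\|_z\le C\,\|\hat W^0\|_z,\qquad 1\le n\le N.$$
   Context: Data: $d,\mu,h_0,T,L$ are positive constants; $f:\mathbb{R}\to\mathbb{R}$ is differentiable and satisfies $-Lu\le f(u)\le Lu$ and $|f'(u)|\le L$ for all $u\ge 0$. The initial function satisfies $u_0\in C^2([0,h_0])$, $u_0'(0)=0$, $u_0(h_0)=0$, and $u_0(r)>0$ for $0\le r<h_0$. Mesh: $M\ge2$ and $N\ge1$ are integers, $\Delta\hat z=1/M$, $\Delta t=T/N$, $\hat z_j=j\Delta\hat z$ for $0\le j\le M$. Difference operators: $\delta_t U_j^n=\frac{U_j^n-U_j^{n-1}}{\Delta t}$, $\delta_t Q^n=\frac{Q^n-Q^{n-1}}{\Delta t}$, $\delta_{\hat z} U_{j+\frac12}^n=\frac{U_{j+1}^n-U_j^n}{\Delta\hat z}$ for $0\le j\le M-1$, and $\delta_{\hat z}^2U_j^n=\frac1{\Delta\hat z}\bigl(\delta_{\hat z}U_{j+\frac12}^n-\delta_{\hat z}U_{j-\frac12}^n\bigr)$ for $1\le j\le M-1$. Scheme (S3) (a discretization of the radially symmetric problem $u_t-d(u_{rr}+\frac1ru_r)=f(u)$ on $0<r<h(t)$, $u_r(t,0)=0$,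 $u(t,h(t))=0$, $h'(t)=-\mu u_r(t,h(t))$, $h(0)=h_0$, $u(0,r)=u_0(r)$, after the change of variables $\hat z=r/h(t)$, $\hat w(t,\hat z)=u(t,r)$, $\hat r(t)=h^2(t)$; $\hat W_j^n,\hat R^n$ approximate $\hat w(t_n,\hat z_j),\hat r(t_n)$ with $t_n=n\Delta t$): the initial values are $\hat R^0=h_0^2$, $\hat W_j^0=u_0(\hat z_jh_0)$, $0\le j\le M$, and for $1\le n\le N$ $$\hat R^n\hat z_j\,\delta_t\hat W_j^n-d\,\hat z_j\,\delta_{\hat z}^2\hat W_j^n-\Bigl(d+\frac{\hat z_j^2\,\delta_t\hat R^n}{2}\Bigr)\delta_{\hat z}\hat W_{j+\frac12}^n=\hat R^n\hat z_j\,f(\hat W_j^{n-1}),\quad 1\le j\le M-1,$$ $$\delta_{\hat z}\hat W_{\frac12}^n=0,\qquad \hat W_M^n=0,\qquad \delta_t\hat R^n=-2\mu\,\delta_{\hat z}\hat W_{M-\frac12}^{n-1}.$$ Norm: on $V_1=\{(v_j)_{0\le j\le M}: v_M=0\}$, $(u,v)_z=\Delta\hat z\sum_{j=1}^{M-1}\hat z_ju_jv_j$ and $\|u\|_z=\sqrt{(u,u)_z}$. $\hat W^n$ denotes $(\hat W_j^n)_{0\le j\le M}$. *)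

(* Defs.v *)
From HB Require Import structures.
From mathcomp Require Import all_boot all_order all_algebra.
From mathcomp Require Import all_classical all_reals all_analysis.
Set Implicit Arguments.
Unset Strict Implicit.
Unset Printing Implicit Defensive.
Import Order.TTheory GRing.Theory Num.Theory.
Import numFieldNormedType.Exports.
Local Open Scope classical_set_scope.
Local Open Scope ring_scope.

(* Derivative of u at x relative to A: at an endpoint of an interval A this is
   the one-sided derivative, so values of u outside A are irrelevant. *)
Definition derivative_within (R : realType) (A : set R) (u : R -> R) (x l : R) : Prop :=
  (fun y => (u y - u x) / (y - x)) @ within A x^' --> l.

(* The continuity of u1 is implied by its differentiability. *)
Definition C2_on (R : realType) (a b : R) (u : R -> R) : Prop :=
  exists u1 u2 : R -> R,
    [/\ forall x, x \in `[a, b] -> derivative_within `[a, b] u x (u1 x),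
        forall x, x \in `[a, b] -> derivative_within `[a, b] u1 x (u2 x)
      & {within `[a, b], continuous u2}].

(* A grid function (v_j)_{0 <= j <= M} is a map nat -> R of which only the
   values at j <= M are ever used; likewise for the time levels 0 <= n <= N. *)

Definition delta_t (R : realType) (dt : R) (Q : nat -> R) (n : nat) : R :=
  (Q n - Q n.-1) / dt.

(* space difference at the half-integer point j + 1/2 *)
Definition delta_z (R : realType) (dz : R) (v : nat -> R) (j : nat) : R :=
  (v j.+1 - v j) / dz.

(* second space difference at j >= 1; j - 1/2 = (j - 1) + 1/2 *)
Definition delta_z2 (R : realType) (dz : R) (v : nat -> R) (j : nat) : R :=
  (delta_z dz v j - delta_z dz v j.-1) / dz.

Definition mesh_size (R : realType) (M : nat) : R := M%:R^-1.

Definition node (R : realType) (M j : nat) : R := j%:R * mesh_size R M.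

(* W n j and Q n stand for \hat W_j^n and \hat R^n. *)
Record scheme_S3 (R : realType) (d mu h0 T : R) (f u0 : R -> R) (M N : nat)
    (W : nat -> nat -> R) (Q : nat -> R) : Prop := SchemeS3 {
  S3_initQ : Q 0%N = h0 ^+ 2;
  S3_initW : forall j, (j <= M)%N -> W 0%N j = u0 (node R M j * h0);
  S3_eq : forall n j, (1 <= n <= N)%N -> (1 <= j <= M.-1)%N ->
    let dt := T / N%:R in
    let dz := mesh_size R M in
    let z := node R M j in
    Q n * z * delta_t dt (fun k => W k j) n
      - d * z * delta_z2 dz (W n) j
      - (d + z ^+ 2 * delta_t dt Q n / 2) * delta_z dz (W n) j
    = Q n * z * f (W n.-1 j);
  S3_left : forall n, (1 <= n <= N)%N -> delta_z (mesh_size R M) (W n) 0%N = 0;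
  S3_right : forall n, (1 <= n <= N)%N -> W n M = 0;
  S3_front : forall n, (1 <= n <= N)%N ->
    delta_t (T / N%:R) Q n = - 2 * mu * delta_z (mesh_size R M) (W n.-1) M.-1
}.

Definition inner_z (R : realType) (M : nat) (u v : nat -> R) : R :=
  mesh_size R M * \sum_(1 <= j < M) node R M j * u j * v j.

Definition norm_z (R : realType) (M : nat) (u : nat -> R) : R :=
  Num.sqrt (inner_z M u u).

(* Main.v *)
Require Import Defs.
From HB Require Import structures.
From mathcomp Require Import all_boot all_order all_algebra.
From mathcomp Require Import all_classical all_reals all_analysis.
From mathcomp Require Import ring lra.
Import Order.TTheory GRing.Theory Num.Theory.
Import numFieldNormedType.Exports.
Local Open Scope classical_set_scope.
Local Open Scope ring_scope.

(** The estimate is the discrete energy inequality for the weight z, made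
    possible by the sign of the front speed.

    The sign comes from a minimum principle. With dt <= 1/L the explicit
    reaction term satisfies w + dt f(w) >= 0 for w >= 0, so each implicit step
    solves a linear system with an M-matrix and a nonnegative right-hand side;
    hence W^n >= 0 ([scheme_S3_invariant]). Since W^n vanishes at z = 1, its
    last space difference is then nonpositive, so the squared radius Q is
    nondecreasing and stays above h0^2 > 0.

    Now multiply the equation at level n by W_j^n and sum over j. The
    combination z delta_z^2 + delta_z is the conservative difference of
    z delta_z, so summation by parts makes the diffusion contribute a
    nonpositive quantity ([diffusion_dissipative]). The transport term has the
    factor delta_t Q >= 0 and is nonpositive as well, because
    a (b - a) <= (b^2 - a^2) / 2 and the weight z^2 increases
    ([transport_dissipative]). What is left is
      (W^n, W^n - W^(n-1))_z <= dt (f(W^(n-1)), W^n)_z,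
    and f(w) <= L w with Young's inequality gives
      (1 - L dt) |W^n|^2 <= (1 + L dt) |W^(n-1)|^2    ([inner_z_step]).
    As L dt < 1/2, the quotient of the two factors is at most
    1 + 4 L dt <= exp(4 L dt), and N steps multiply the squared norm by at most
    exp(4 L T), whatever the mesh. *)

(** * Inequalities for grid functions *)

(** At an interior minimum both neighbour differences are nonnegative, so a
    negative minimum would make the combination in the last hypothesis
    negative. The condition [v 0 = v 1] excludes a minimum that is attained only at the left end. *)
Lemma discrete_min_principle {R : realType} (M : nat) (v a b c : nat -> R) :
  (2 <= M)%N -> v 0%N = v 1%N -> 0 <= v M ->
  (forall j, (1 <= j < M)%N -> 0 < a j) ->
  (forall j, (1 <= j < M)%N -> 0 <= b j) ->
  (forall j, (1 <= j < M)%N -> 0 <= c j) ->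
  (forall j, (1 <= j < M)%N ->
    0 <= a j * v j - b j * (v j.-1 - v j) - c j * (v j.+1 - v j)) ->
  forall j, (j <= M)%N -> 0 <= v j.
Proof.
move=> M2 v01 vM a0 b0 c0 Hv j0 j0M.
have [m mM vmin] : exists2 m, (m <= M)%N &
    forall j, (j <= M)%N -> v m <= v j.
  case: (arg_minP (fun i : 'I_M.+1 => v i) (i0 := ord0) (P := predT) isT).
  move=> i _ imin; exists i; first by rewrite -ltnS.
  by move=> j jM; have := imin (Ordinal (jM : (j < M.+1)%N)) isT.
suff vm0 : 0 <= v m by exact: le_trans vm0 (vmin _ j0M).
rewrite leNgt; apply/negP => vm_lt0.
have [i iM vi] : exists2 i, (1 <= i < M)%N & v i = v m.
  case: m mM vm_lt0 vmin => [|m] mM vm_lt0 vmin; first by exists 1%N.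
  exists m.+1 => //=; rewrite ltn_neqAle mM andbT.
  by apply: contraTneq vm_lt0 => ->; rewrite -leNgt.
have /andP[i1 iltM] := iM.
have vp : 0 <= v i.-1 - v i.
  by rewrite subr_ge0 vi vmin // (leq_trans (leq_pred _)) // ltnW.
have vs : 0 <= v i.+1 - v i by rewrite subr_ge0 vi vmin.
have vi0 : v i < 0 by rewrite vi.
have := Hv i iM.
have := mulr_ge0 (b0 i iM) vp; have := mulr_ge0 (c0 i iM) vs.
have : a i * v i < 0 by rewrite pmulr_rlt0 ?a0.
lra.
Qed.

(** Summation by parts: up to boundary terms the sum is minus the weighted sum
    of the squared differences. The boundary term on the left vanishes because
    [v 1 = v 0], and the one on the right is [- M * v (M - 1) ^ 2]. *)
Lemma diffusion_dissipative {R : realType} (M : nat) (v : nat -> R) :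
  (1 <= M)%N -> v 1%N = v 0%N -> v M = 0 ->
  \sum_(1 <= j < M)
    (j.+1%:R * (v j.+1 - v j) - j%:R * (v j - v j.-1)) * v j <= 0.
Proof.
move=> M1 v10 vM.
have partial k : \sum_(1 <= j < k.+1)
    (j.+1%:R * (v j.+1 - v j) - j%:R * (v j - v j.-1)) * v j
    <= k.+1%:R * (v k.+1 - v k) * v k.
  elim: k => [|k IH]; first by rewrite big_nil v10 subrr mulr0 mul0r.
  rewrite big_nat_recr //=.
  have : 0 <= k.+1%:R * (v k.+1 - v k) ^+ 2 by rewrite mulr_ge0 ?sqr_ge0.
  by move: IH; move: (k.+1%:R) (k.+2%:R) => x y; lra.
case: M M1 vM => // m _ vM; apply: le_trans (partial m) _.
rewrite vM sub0r mulrN mulNr oppr_le0 -mulrA.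
by rewrite mulr_ge0 // -expr2 sqr_ge0.
Qed.

(** Each term is at most [j ^ 2 * (v (j+1) ^ 2 - v j ^ 2) / 2], and by parts
    the increasing weight [j ^ 2] turns the sum of these into a nonpositive
    one. *)
Lemma transport_dissipative {R : realType} (M : nat) (v : nat -> R) :
  (1 <= M)%N -> v M = 0 ->
  \sum_(1 <= j < M) j%:R ^+ 2 * (v j.+1 - v j) * v j <= 0.
Proof.
move=> M1 vM.
have partial k : \sum_(1 <= j < k.+1) j%:R ^+ 2 * (v j.+1 - v j) * v j
    <= k%:R ^+ 2 * v k.+1 ^+ 2 / 2.
  elim: k => [|k IH]; first by rewrite big_nil expr0n /= !mul0r.
  rewrite big_nat_recr //=.
  have : 0 <= k.+1%:R ^+ 2 * (v k.+2 - v k.+1) ^+ 2.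
    by rewrite mulr_ge0 ?sqr_ge0.
  have : k%:R ^+ 2 * v k.+1 ^+ 2 <= k.+1%:R ^+ 2 * v k.+1 ^+ 2.
    by rewrite ler_wpM2r ?sqr_ge0 // ler_pXn2r ?nnegrE // ler_nat.
  by move: IH; move: (k%:R ^+ 2) (k.+1%:R ^+ 2) => x y; lra.
case: M M1 vM => // m _ vM; apply: le_trans (partial m) _.
by rewrite vM expr0n /= mulr0 mul0r.
Qed.

(** * The scheme in conservative form *)

(** After the denominators [1 / M] are cleared, the radial diffusion part
    [j * (v (j+1) - 2 v j + v (j-1)) + (v (j+1) - v j)] is the difference of the
    fluxes [(j+1) * (v (j+1) - v j)] and [j * (v j - v (j-1))], the form that
    summation by parts needs. *)
Lemma scheme_S3_eq_conservative {R : realType} {d mu h0 T : R} {f u0 : R -> R}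
    {M N : nat} {W : nat -> nat -> R} {Q : nat -> R}
    (S : scheme_S3 d mu h0 T f u0 M N W Q) (n j : nat) :
  (2 <= M)%N -> (1 <= n <= N)%N -> (1 <= j < M)%N ->
  let dt := T / N%:R in
  Q n * node R M j * ((W n j - W n.-1 j) / dt) =
    d * M%:R * (j.+1%:R * (W n j.+1 - W n j) - j%:R * (W n j - W n j.-1))
    + delta_t dt Q n / 2 * M%:R^-1 * (j%:R ^+ 2 * (W n j.+1 - W n j))
    + Q n * node R M j * f (W n.-1 j).
Proof.
move=> M2 nN /andP[j1 jM] dt.
have jM' : (1 <= j <= M.-1)%N by rewrite j1 -ltnS prednK // (leq_trans _ M2).
have := S3_eq S nN jM'; cbv zeta; rewrite -/dt => <-.
have M0 : M%:R != 0 :> R by rewrite pnatr_eq0 -lt0n (leq_trans _ M2).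
rewrite /delta_z2 /delta_z /node /mesh_size !invrK prednK //.
rewrite -natr1 [delta_t dt (W^~ j) n]/delta_t /=.
move: (delta_t dt Q n) (dt^-1) => s ti.
by field.
Qed.

(** * Signs preserved by the scheme *)

(** The minimum principle and the monotonicity of the squared radius have to be
    proved together: the coefficients of the system at level [n] are positive
    because [Q] has not decreased, which rests on the sign of [W] at the level
    before. *)
Lemma scheme_S3_invariant {R : realType} {d mu h0 T L : R} {f u0 : R -> R}
    {M N : nat} {W : nat -> nat -> R} {Q : nat -> R} :
  0 < d -> 0 < mu -> 0 < h0 -> 0 < T ->
  (forall u : R, 0 <= u -> - L * u <= f u) ->
  (forall r : R, 0 <= r <= h0 -> 0 <= u0 r) -> u0 h0 = 0 ->
  (2 <= M)%N -> (1 <= N)%N -> L * (T / N%:R) <= 1 ->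
  scheme_S3 d mu h0 T f u0 M N W Q ->
  forall n, (n <= N)%N ->
  [/\ 0 < Q n, W n M = 0, forall j, (j <= M)%N -> 0 <= W n j
    & (1 <= n)%N -> 0 <= delta_t (T / N%:R) Q n].
Proof.
move=> d0 mu0 h0_gt0 T0 fL u0_ge0 u0h M2 N1 Ldt S.
set dt := T / N%:R.
have dt0 : 0 < dt by rewrite divr_gt0 // ltr0n.
have M0 : (0 < M%:R :> R) by rewrite ltr0n (leq_trans _ M2).
elim=> [_|n IH nN].
  split=> //.
  - by rewrite (S3_initQ S) exprn_gt0.
  - by rewrite (S3_initW S) // /node /mesh_size divff ?gt_eqF // mul1r.
  move=> j jM; rewrite (S3_initW S) // u0_ge0 // /node /mesh_size.
  rewrite mulr_ge0 ?divr_ge0 ?(ltW h0_gt0) //=.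
  by rewrite ler_piMl ?(ltW h0_gt0) // ler_pdivrMr // mul1r ler_nat.
have [Qn WnM Wn _] := IH (ltnW nN).
have nN1 : (1 <= n.+1 <= N)%N by [].
have dQ : 0 <= delta_t dt Q n.+1.
  rewrite (S3_front S nN1) /= /delta_z prednK ?(leq_trans _ M2) // WnM sub0r.
  rewrite !(mulNr, mulrN) opprK.
  by rewrite !mulr_ge0 ?(ltW mu0) ?invr_ge0 ?Wn ?leq_pred // /mesh_size invr_ge0.
have Qn1 : 0 < Q n.+1.
  apply: lt_le_trans Qn _; move: dQ; rewrite /delta_t /=.
  by rewrite pmulr_lge0 ?invr_gt0 // subr_ge0.
have W01 : W n.+1 0%N = W n.+1 1%N.
  have /eqP := S3_left S nN1; rewrite /delta_z mulf_eq0 invr_eq0 /mesh_size.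
  by rewrite invr_eq0 (gt_eqF M0) orbF subr_eq0 => /eqP.
have WM := S3_right S nN1.
split=> //.
(* The forward difference carries one part of the diffusion flux and all of
   the transport. *)
pose e j := delta_t dt Q n.+1 / 2 * M%:R^-1 * j%:R ^+ 2.
have c0 : 0 <= delta_t dt Q n.+1 / 2 * M%:R^-1.
  by apply: divr_ge0 => //; apply: divr_ge0.
have e0 j : 0 <= e j by rewrite mulr_ge0 ?sqr_ge0.
apply: (@discrete_min_principle R M (W n.+1)
  (fun j => Q n.+1 * node R M j / dt) (fun j => d * M%:R * j%:R)
  (fun j => d * M%:R * j.+1%:R + e j)) => //.
- by rewrite WM.
- move=> j /andP[j1 _].
  by rewrite !mulr_gt0 ?invr_gt0 ?ltr0n ?(leq_trans _ M2).
- by move=> j _; rewrite !mulr_ge0 // ltW.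
- by move=> j _; rewrite addr_ge0 // !mulr_ge0 // ltW.
move=> j jM; have /andP[j1 jltM] := jM.
have /= E := scheme_S3_eq_conservative S _ _ M2 nN1 jM.
have Wj : 0 <= W n j by rewrite Wn // ltnW.
have rhs : 0 <= W n j / dt + f (W n j).
  have : L * W n j <= W n j / dt.
    rewrite ler_pdivlMr // mulrAC -[leRHS]mul1r.
    by rewrite ler_wpM2r.
  by have := fL _ Wj; lra.
have Qz : 0 <= Q n.+1 * node R M j.
  by rewrite mulr_ge0 ?(ltW Qn1) // divr_ge0 // ltW.
have := mulr_ge0 Qz rhs; move: E; rewrite -/dt /e.
by move: (dt^-1) (M%:R^-1) (node R M j) => *; lra.
Qed.

(** * Stability *)

Lemma inner_z_ge0 {R : realType} (M : nat) (u : nat -> R) : 0 <= inner_z M u u.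
Proof.
rewrite mulr_ge0 ?invr_ge0 // sumr_ge0 // => j _.
by rewrite -mulrA mulr_ge0 -?expr2 ?sqr_ge0 // divr_ge0.
Qed.

(** The bound [f u <= L * u] can be multiplied by [W n j] only because the
    latter is nonnegative; Young's inequality then splits the product
    [W n j * W n.-1 j] between the two time levels. *)
Lemma inner_z_step {R : realType} {d mu h0 T L : R} {f u0 : R -> R}
    {M N : nat} {W : nat -> nat -> R} {Q : nat -> R} {n : nat} :
  0 < d -> 0 < T -> 0 <= L -> (forall u : R, 0 <= u -> f u <= L * u) ->
  (2 <= M)%N -> scheme_S3 d mu h0 T f u0 M N W Q ->
  (1 <= n <= N)%N -> 0 < Q n -> 0 <= delta_t (T / N%:R) Q n ->
  (forall j, (j <= M)%N -> 0 <= W n j) ->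
  (forall j, (j <= M)%N -> 0 <= W n.-1 j) ->
  (1 - L * (T / N%:R)) * inner_z M (W n) (W n) <=
  (1 + L * (T / N%:R)) * inner_z M (W n.-1) (W n.-1).
Proof.
move=> d0 T0 L0 fL M2 S nN Qn dQ Wn Wp.
set dt := T / N%:R.
have dt0 : 0 < dt.
  by rewrite divr_gt0 // ltr0n; case/andP: nN => ?; exact: leq_trans.
have M0 : (0 < M%:R :> R) by rewrite ltr0n (leq_trans _ M2).
have M1 : (1 <= M)%N by exact: leq_trans M2.
have W10 : W n 1%N = W n 0%N.
  have /eqP := S3_left S nN; rewrite /delta_z mulf_eq0 invr_eq0 /mesh_size.
  by rewrite invr_eq0 (gt_eqF M0) orbF subr_eq0 => /eqP.
have WM := S3_right S nN.
have diff := diffusion_dissipative _ _ M1 W10 WM.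
have tran := transport_dissipative _ _ M1 WM.
pose z := node R M.
have energy : \sum_(1 <= j < M) z j * W n j * (W n j - W n.-1 j)
    <= \sum_(1 <= j < M) dt * (z j * W n j * f (W n.-1 j)).
  rewrite -mulr_sumr -ler_pdivrMl // -(ler_pM2l Qn) mulrCA !mulr_sumr.
  rewrite -subr_le0 -sumrB.
  set lhs := (X in X <= 0).
  have -> : lhs =
      d * M%:R * (\sum_(1 <= j < M)
        (j.+1%:R * (W n j.+1 - W n j) - j%:R * (W n j - W n j.-1)) * W n j)
      + delta_t dt Q n / 2 * M%:R^-1 *
        (\sum_(1 <= j < M) j%:R ^+ 2 * (W n j.+1 - W n j) * W n j).
    rewrite !mulr_sumr -big_split; apply: eq_big_nat => j jM.
    have /= := scheme_S3_eq_conservative S _ _ M2 nN jM; rewrite -/dt -/(z j).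
    move=> /(congr1 (fun x => x * W n j)).
    by move: (delta_t dt Q n) (dt^-1) (M%:R^-1) => *; lra.
  rewrite -oppr_ge0 opprD -!mulrN addr_ge0 // mulr_ge0 ?oppr_ge0 //.
    by rewrite mulr_ge0 // ltW.
  by apply: divr_ge0 => //; apply: divr_ge0.
rewrite /inner_z mulrCA [leRHS]mulrCA ler_pM2l ?invr_gt0 //.
have young : \sum_(1 <= j < M) dt * (z j * W n j * f (W n.-1 j))
    - \sum_(1 <= j < M) z j * W n j * (W n j - W n.-1 j)
    <= ((1 + L * dt) * (\sum_(1 <= j < M) z j * W n.-1 j * W n.-1 j)
    - (1 - L * dt) * (\sum_(1 <= j < M) z j * W n j * W n j)) / 2.
  rewrite !mulr_sumr -!sumrB mulr_suml; apply: ler_sum_nat => j /andP[_ jM].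
  have z0 : 0 <= z j by rewrite divr_ge0 // ltW.
  have := ler_wpM2l (mulr_ge0 (ltW dt0) (mulr_ge0 z0 (Wn _ (ltnW jM))))
    (fL _ (Wp _ (ltnW jM))).
  have Ldt0 : 0 <= 1 + L * dt by rewrite addr_ge0 // mulr_ge0 // ltW.
  have := mulr_ge0 Ldt0 (mulr_ge0 z0 (sqr_ge0 (W n j - W n.-1 j))).
  lra.
by move: energy young; lra.
Qed.

Theorem theorem3p6 (R : realType) (d mu h0 T L : R) (f u0 : R -> R)
  (d_gt0 : 0 < d) (mu_gt0 : 0 < mu) (h0_gt0 : 0 < h0) (T_gt0 : 0 < T) (L_gt0 : 0 < L)
  (f_derivable : forall u : R, derivable f u 1)
  (f_bounds : forall u : R, 0 <= u -> - L * u <= f u <= L * u)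
  (f'_bound : forall u : R, 0 <= u -> `|(f^`())%classic u| <= L)
  (u0_C2 : C2_on 0 h0 u0)
  (u0'_0 : derivative_within `[0, h0] u0 0 0)
  (u0_h0 : u0 h0 = 0)
  (u0_gt0 : forall r : R, 0 <= r < h0 -> 0 < u0 r) :
  exists C : R, 0 < C /\
    forall M N : nat, (2 <= M)%N -> (1 <= N)%N -> T / N%:R < (2 * L)^-1 ->
    forall (W : nat -> nat -> R) (Q : nat -> R),
      scheme_S3 d mu h0 T f u0 M N W Q ->
      forall n, (1 <= n <= N)%N -> norm_z M (W n) <= C * norm_z M (W 0%N).
Proof.
exists (Num.sqrt (expR (4 * L * T))); split; first by rewrite sqrtr_gt0 expR_gt0.
move=> M N M2 N1 dtL W Q S n /andP[n1 nN].
have dt0 : 0 < T / N%:R by rewrite divr_gt0 // ltr0n.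
have Ldt : L * (T / N%:R) < 2^-1.
  by rewrite mulrC -ltr_pdivlMr // -invfM.
have Ldt1 : L * (T / N%:R) <= 1 by lra.
have u0_ge0 (r : R) : 0 <= r <= h0 -> 0 <= u0 r.
  move=> /andP[r0]; rewrite le_eqVlt => /predU1P[->|rh]; first by rewrite u0_h0.
  by rewrite ltW // u0_gt0 // r0.
have inv : forall k, (k <= N)%N -> _ :=
  scheme_S3_invariant d_gt0 mu_gt0 h0_gt0 T_gt0
  (fun u uge0 => proj1 (andP (f_bounds u uge0))) u0_ge0 u0_h0 M2 N1
  Ldt1 S.
have growth k : (k <= N)%N -> inner_z M (W k) (W k)
    <= expR (4 * (L * (T / N%:R)) * k%:R) * inner_z M (W 0%N) (W 0%N).
  elim: k => [_|k IH kN]; first by rewrite mulr0 expR0 mul1r.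
  have [_ _ Wk _] := inv k (ltnW kN).
  have [Qk1 _ Wk1 dQ] := inv k.+1 kN.
  have := inner_z_step d_gt0 T_gt0 (ltW L_gt0) (fun u uge0 => proj2 (andP (f_bounds u uge0)))
    M2 S (n := k.+1) kN Qk1 (dQ isT) Wk1 Wk.
  rewrite -pred_Sn => step.
  have [x0 I0] : 0 < L * (T / N%:R) /\ 0 <= inner_z M (W k) (W k).
    by rewrite mulr_gt0 // inner_z_ge0.
  rewrite -[k.+1%:R]natr1 mulrDr mulr1 addrC expRD -mulrA.
  move: (IH (ltnW kN)); rewrite -(ler_pM2l (expR_gt0 (4 * (L * (T / N%:R))))).
  apply: le_trans.
  apply: (@le_trans _ _ ((1 + 4 * (L * (T / N%:R))) * inner_z M (W k) (W k))).
    rewrite -(@ler_pM2l _ (1 - L * (T / N%:R))); last by lra.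
    apply: le_trans step _; rewrite [leRHS]mulrA ler_wpM2r //.
    (* (1 - x) (1 + 4 x) - (1 + x) = 2 x (1 - 2 x) *)
    have : 0 <= L * (T / N%:R) * (2^-1 - L * (T / N%:R)).
      by rewrite mulr_ge0 ?subr_ge0 // ltW.
    lra.
  by rewrite ler_wpM2r // expR_ge1Dx.
rewrite /norm_z -sqrtrM ?expR_ge0 // ler_wsqrtr //.
apply: le_trans (growth n nN) _.
rewrite ler_wpM2r ?inner_z_ge0 // ler_expR -!mulrA !ler_pM2l ?ltr0n //.
by rewrite ler_piMr ?(ltW T_gt0) // mulrC ler_pdivrMr ?ltr0n // mul1r ler_nat.
Qed.
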